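(* Let $\pi$ be a probability distribution on $\Omega\subseteq\mathbb{R}^d$, let $f:\Omega\to\mathbb{R}$ be measurable and integrable with respect to $\pi$, and let $(\bm X_t)_{t\ge0}$ and $(\bm Y_t)_{t\ge0}$ be two $\Omega$-valued stochastic processes on a common probability space (not assumed to be Markov) such that $\bm X_t$ and $\bm Y_t$ have the same distribution for every $t\ge0$. Assume: (1) $\mathbb{E}[f(\bm X_t)]\to \mathbb{E}_\pi[f(\bm X)]$ as $t\to\infty$, and there are $\eta>0$ and $D<\infty$ such that $\mathbb{E}\left[|f(\bm X_t)|^{2+\eta}\right]\le D$ for all $t\ge0$. (2) The first meeting time $\tau=\inf\{t\ge1:\bm X_t=\bm Y_{t-1}\}$ is a random variable satisfying $\mathbb{P}(\tau>t)\le C\delta^t$ for all $t\ge0$, for some constants $C<\infty$ and $\delta\in(0,1)$. (3) $\bm X_t=\bm Y_{t-1}$ for all $t\ge\tau$. For integers $k\ge0$, $N>0$ and $m=N+k-1$, let $$\mathrm{BC}_{k:m}=\sum_{l=k+1}^{\tau-1}\min\left(1,\frac{l-k}{m-k+1}\right)\{f(\bm X_l)-f(\bm Y_{l-1})\}$$ (zero if $\tau-1<k+1$). Then for all integers $k\ge0$, $N>0$ and $m=N+k-1$, $$\mathbb{E}\left[\mathrm{BC}_{k:m}^2\right]\le C_\delta\,\frac{\hat\delta^{2k}}{N^2},$$ where $\hat\delta=\delta^{\frac{\eta}{4+2\eta}}$ and $$C_\delta=4D^{\frac{2}{2+\eta}}C^{\frac{\eta}{2+\eta}}\;\frac{3+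2\left(\left(-\frac{\hat\delta^{(-1/\ln(\hat\delta))}}{\ln(\hat\delta)}\right)\frac{1-\hat\delta}{\hat\delta}\right)^2}{\left(\frac{(1-\hat\delta)^2}{\hat\delta}\right)^2}.$$
   Context: $\mathbb{E}_\pi[f(\bm X)]$ denotes the expectation of $f(\bm X)$ when $\bm X\sim\pi$. $\ln$ is the natural logarithm. *)

(* Defs.v *)
From HB Require Import structures.
From mathcomp Require Import all_boot all_order all_algebra.
From mathcomp Require Import all_classical all_reals all_analysis.
From mathcomp Require Import measurable_realfun.

Set Implicit Arguments.
Unset Strict Implicit.
Unset Printing Implicit Defensive.

Import Order.TTheory GRing.Theory Num.Theory.
Import numFieldNormedType.Exports.

Local Open Scope classical_set_scope.
Local Open Scope ring_scope.

(* Measurable types are pointed, hence the witness x0 that S is nonempty. *)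
Section pointed_subset.
Variables (T : choiceType) (S : set T) (x0 : T) (Sx0 : S x0).

Definition pointed_subset of S x0 := set_type S.

HB.instance Definition _ := Choice.on (@pointed_subset Sx0).
HB.instance Definition _ :=
  isPointed.Build (@pointed_subset Sx0) (SigSub (mem_set Sx0) : set_type S).

End pointed_subset.

(* A nonempty subset S of R^d, not assumed to be Borel, with the trace on S of
   the Borel sigma-algebra of R^d (the product sigma-algebra of d.-tuple R):
   the measurable sets are the S `&` B with B Borel. *)
Definition borel_subspace (R : realType) (d : nat) (S : set (d.-tuple R))
    (x0 : d.-tuple R) (Sx0 : S x0) :=
  g_sigma_algebra_preimageType
    ((fun x => set_val x) : pointed_subset Sx0 -> d.-tuple R).

(* Equal to +oo on the event that the two processes never meet. *)
Definition meeting_time (R : realType) (T E : Type) (X Y : nat -> T -> E)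
    (w : T) : \bar R :=
  ereal_inf [set t%:R%:E | t in
    [set t : nat | (1 <= t)%N /\ X t w = Y t.-1 w]].

(* The index l runs over k+1 <= l <= tau-1.  As fine +oo = 0, the sum is 0 where
   tau = +oo, which is a null event as soon as P(tau > t) tends to 0. *)
Definition bias_correction (R : realType) (T E : Type) (f : E -> R)
    (X Y : nat -> T -> E) (k m : nat) (w : T) : R :=
  \sum_(k.+1 <= l < Num.truncn (fine (meeting_time R X Y w)))
    Num.min 1 ((l%:R - k%:R) / (m%:R - k%:R + 1))
    * (f (X l w) - f (Y l.-1 w)).

Definition delta_hat (R : realType) (delta eta : R) : R :=
  delta `^ (eta / (4 + 2 * eta)).

Definition C_delta (R : realType) (C D delta eta : R) : R :=
  let h := delta_hat delta eta in
  4 * D `^ (2 / (2 + eta)) * C `^ (eta / (2 + eta))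
  * ((3 + 2 * ((- (h `^ (- 1 / ln h) / ln h)) * ((1 - h) / h)) ^+ 2)
     / ((1 - h) ^+ 2 / h) ^+ 2).

(* Main.v *)
(* Write [h = delta_hat] and [Z_l = f(X_l) - f(Y_{l-1})].  Minkowski's inequality
   gives [||Z_l||_{2+eta} <= 2 D^{1/(2+eta)}], so Hoelder's inequality against the
   indicator of [tau > l] bounds [E[Z_l^2 1_{tau > l}]] by [K h^{2l}] with
   [K = 4 D^{2/(2+eta)} C^{eta/(2+eta)}].  As the weights are at most [(l-k)/N],
   Minkowski's inequality in L^2 yields
     [E[BC^2] <= K (\sum_{l > k} (l-k)/N h^l)^2 = K (h^{k+1} / (N (1-h)^2))^2],
   which is the stated bound with [3 + 2 (...)^2] replaced by [1]. *)
Require Import Defs.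
From HB Require Import structures.
From mathcomp Require Import all_boot all_order all_algebra.
From mathcomp Require Import all_classical all_reals all_analysis.
From mathcomp Require Import measurable_realfun.
From mathcomp Require Import ring lra.

Set Implicit Arguments.
Unset Strict Implicit.
Unset Printing Implicit Defensive.

Import Order.TTheory GRing.Theory Num.Theory.
Import numFieldNormedType.Exports.

Local Open Scope classical_set_scope.
Local Open Scope ring_scope.

(** * Elementary inequalities for finite sums *)

(* Truncated subtraction: the terms with [l <= k] vanish. *)
Lemma sum_natr_expr_le (R : realFieldType) (h : R) (k n : nat) :
  0 < h -> h < 1 ->
  \sum_(l < n) (l - k)%:R * h ^+ l <= h ^+ k * (h / (1 - h) ^+ 2).
Proof.
move=> h0 h1; have h10 : 1 - h != 0 by lra.
elim: k n => [n|k IHk [|n]].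
- rewrite expr0 mul1r.
  (* The added fraction is the tail of the series from [n] on. *)
  have -> : h / (1 - h) ^+ 2 = \sum_(l < n) (l - 0)%:R * h ^+ l
      + (n%:R * h ^+ n * (1 - h) + h ^+ n * h) / (1 - h) ^+ 2.
    elim: n => [|n IHn].
      by rewrite big_ord0 mul0r expr0 mul1r !add0r mul0r add0r.
    rewrite big_ord_recr/= IHn subn0 -natr1 (exprSr h n).
    by field.
  have oneBh_ge0 : 0 <= 1 - h by lra.
  by rewrite lerDl divr_ge0 ?exprn_ge0// addr_ge0// !mulr_ge0 ?exprn_ge0// ltW.
- by rewrite big_ord0 mulr_ge0 ?divr_ge0 ?exprn_ge0//; lra.
(* The term of index 0 vanishes, and shifting the others by one extracts the factor [h] that
   separates [k.+1] from [k]. *)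
- rewrite big_ord_recl mul0r add0r exprS -mulrA.
  under eq_bigr => l _ do rewrite lift0 subSS exprS mulrCA.
  by rewrite -mulr_sumr ler_pM2l.
Qed.

(** Cauchy-Schwarz with weights [b l] for [sqrt (c l)] and [u l / sqrt (c l)], in a form free of
    square roots. *)
Lemma sqr_sum_le (R : realFieldType) (n : nat) (b c u : nat -> R) (S : R) :
  (forall l, 0 <= b l) -> (forall l, 0 < c l) -> 0 < S ->
  \sum_(l < n) b l * c l <= S ->
  (\sum_(l < n) b l * u l) ^+ 2 <= S * \sum_(l < n) b l * (u l ^+ 2 / c l).
Proof.
move=> b0 c0 S0 hS; set s := \sum_(l < n) b l * u l.
set q := \sum_(l < n) b l * (u l ^+ 2 / c l).
(* Sum the inequalities [2 t u <= t^2 c + u^2 / c] at the optimal [t = s / S]. *)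
have key : 2 * (s / S) * s <= (s / S) ^+ 2 * S + q.
  apply: (@le_trans _ _ ((s / S) ^+ 2 * (\sum_(l < n) b l * c l) + q)); last first.
    by rewrite lerD2r ler_wpM2l ?sqr_ge0.
  rewrite {2}/s /q !mulr_sumr -big_split/=; apply: ler_sum => l _.
  rewrite -subr_ge0.
  have -> : (s / S) ^+ 2 * (b l * c l) + b l * (u l ^+ 2 / c l)
     - 2 * (s / S) * (b l * u l)
    = b l * (((s / S) * c l - u l) ^+ 2 / c l).
    by field; rewrite gt_eqF ?c0// gt_eqF.
  by rewrite mulr_ge0 ?divr_ge0 ?sqr_ge0// ltW.
have -> : s ^+ 2 = S * (2 * (s / S) * s - (s / S) ^+ 2 * S).
  by field; rewrite gt_eqF.
by rewrite ler_pM2l// lerBlDl.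
Qed.

(** * Second moments of weighted sums and of truncated variables *)

Section expectation_bounds.
Context d (T : measurableType d) (R : realType) (P : probability T R).

(** The integral of a nonnegative function is a supremum over the simple functions below it, so
    monotonicity holds without measurability. This allows an arbitrary function [W] below. *)
Lemma le_integral_nonneg (f g : T -> \bar R) :
  (forall x, 0 <= f x)%E -> (forall x, f x <= g x)%E ->
  (\int[P]_x f x <= \int[P]_x g x)%E.
Proof.
move=> f0 fg; rewrite !ge0_integralTE//; last by move=> x; exact: le_trans (fg x).
apply: le_ereal_sup => _ [h hf <-]; exists h => // x.
exact: le_trans (fg x).
Qed.

(* Minkowski's inequality in [L^2] for infinite sums, in weighted form. *)
Lemma expectation_sqr_sum_le (b c : nat -> R) (u : nat -> T -> R) (W : T -> R)
    (K S : R) :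
  (forall l, 0 <= b l) -> (forall l, 0 < c l) -> 0 < S ->
  (forall n, \sum_(l < n) b l * c l <= S) ->
  (forall l, measurable_fun [set: T] (u l)) ->
  (forall l, 'E_P[fun w => (u l w ^+ 2)%R] <= (K * c l ^+ 2)%:E)%E ->
  (forall w, exists n, `|W w| <= \sum_(l < n) b l * `|u l w|) ->
  ('E_P[fun w => (W w ^+ 2)%R] <= (K * S ^+ 2)%:E)%E.
Proof.
move=> b0 c0 S0 hS mu hu hW.
have bc0 l : 0 <= b l / c l by rewrite divr_ge0// ltW.
have K0 : 0 <= K.
  have : (0 <= (K * c 0%N ^+ 2)%:E)%E.
    apply: le_trans (hu 0%N); rewrite unlock integral_ge0// => x _.
    by rewrite lee_fin sqr_ge0.
  by rewrite lee_fin pmulr_lge0 ?exprn_gt0.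
have mu2 l : measurable_fun [set: T] (fun w => (u l w ^+ 2)%:E).
  by apply/measurable_EFinP; exact: measurable_funX.
(* Cauchy-Schwarz applies up to the index [n] given by [w]; passing to the whole series removes this
   dependence on [w]. *)
have hW2 w : ((W w ^+ 2)%:E <=
    S%:E * \sum_(0 <= l <oo) ((b l / c l)%:E * (u l w ^+ 2)%:E))%E.
  have [n hn] := hW w.
  apply: (@le_trans _ _ (S * \sum_(l < n) b l * (u l w ^+ 2 / c l))%:E).
    rewrite lee_fin -real_normK ?num_real//.
    apply: le_trans (_ : (\sum_(l < n) b l * `|u l w|) ^+ 2 <= _).
      by rewrite lerXn2r ?nnegrE ?sumr_ge0// => i _; rewrite mulr_ge0.
    under [X in S * X]eq_bigr do rewrite -real_normK ?num_real//.
    exact: (@sqr_sum_le _ _ b c (fun l => `|u l w|)).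
  rewrite EFinM lee_pmul2l//; apply: le_trans (nneseries_lim_ge n _); last first.
    by move=> l _ _; rewrite -EFinM lee_fin mulr_ge0 ?sqr_ge0.
  rewrite big_mkord -sumEFin lee_sum// => i _.
  by rewrite -EFinM lee_fin [leRHS]mulrAC mulrA.
rewrite expectation.unlock.
apply: (le_trans (le_integral_nonneg _ hW2)).
  by move=> x; rewrite lee_fin sqr_ge0.
have ge0 l w : (0 <= (b l / c l)%:E * (u l w ^+ 2)%:E)%E.
  by rewrite -EFinM lee_fin mulr_ge0 ?sqr_ge0.
have mf l : measurable_fun [set: T] (fun w => (b l / c l)%:E * (u l w ^+ 2)%:E)%E.
  exact: measurable_funeM.
rewrite ge0_integralZl//; last 3 first.
- exact: ge0_emeasurable_sum.
- by move=> x _; apply: nneseries_ge0.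
- by rewrite lee_fin ltW.
rewrite integral_nneseries//.
(* One factor [S] comes from Cauchy-Schwarz, the other from the sum of [b l * c l] left once each
   second moment is bounded by [K * c l ^+ 2]. *)
have -> : K * S ^+ 2 = S * (S * K) by ring.
rewrite EFinM lee_pmul2l//.
apply: lime_le.
  by apply: is_cvg_nneseries => l _ _; exact: integral_ge0.
apply: nearW => n.
apply: (@le_trans _ _ (\sum_(0 <= l < n) (b l * c l * K)%:E)%E).
  apply: lee_sum => l _; rewrite ge0_integralZl ?lee_fin//; last first.
    by move=> x _; rewrite lee_fin sqr_ge0.
  have := hu l; rewrite unlock => /(@lee_wpmul2l _ (b l / c l)%:E).
  rewrite lee_fin bc0 => /(_ isT) /le_trans; apply.
  rewrite -EFinM lee_fin le_eqVlt; apply/orP; left; apply/eqP; field.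
  by rewrite gt_eqF.
by rewrite sumEFin lee_fin -mulr_suml ler_wpM2r// big_mkord.
Qed.

(** Hoelder's inequality for [Z ^+ 2] and [\1_A] with the conjugate exponents [(2 + eta) / 2] and
    [(2 + eta) / eta]. *)
Lemma expectation_sqr_indic_le (Z : T -> R) (A : set T) (eta M Q : R) :
  0 < eta -> 0 <= Q -> measurable_fun [set: T] Z -> measurable A ->
  ('N[P]_(2 + eta)%:E[EFin \o Z] <= M%:E)%E -> (P A <= Q%:E)%E ->
  ('E_P[fun w => ((Z w * \1_A w) ^+ 2)%R]
    <= (M ^+ 2 * Q `^ (eta / (2 + eta)))%:E)%E.
Proof.
move=> eta0 Q0 mZ mA hZ hA.
have p0 : 0 < (2 + eta) / 2 by rewrite divr_gt0//; lra.
have q0 : 0 < (2 + eta) / eta by rewrite divr_gt0//; lra.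
have mZ2 : measurable_fun [set: T] (fun w => Z w ^+ 2) by exact: measurable_funX.
have m1 : measurable_fun [set: T] (\1_A : T -> R) by exact: measurable_indic.
have e2 : 2 + eta != 0 by lra.
have pq : ((2 + eta) / 2)^-1 + ((2 + eta) / eta)^-1 = 1.
  by field; rewrite e2 gt_eqF.
have := hoelder P mZ2 m1 p0 q0 pq.
rewrite Lnorm1 => H; rewrite unlock.
have -> : (\int[P]_w ((Z w * \1_A w) ^+ 2)%:E =
    \int[P]_x `|(EFin \o ((fun w => Z w ^+ 2) \* \1_A)%R) x|)%E.
  apply: eq_integral => w _ /=; congr EFin.
  rewrite exprMn normrM ger0_norm ?sqr_ge0// indicE.
  by case: (_ \in _); rewrite ?normr1 ?normr0 ?expr1n ?expr0n.
apply: (le_trans H); rewrite (EFinM (M ^+ 2)) lee_pmul ?Lnorm_ge0//.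
- have -> : 'N[P]_((2 + eta) / 2)%:E[EFin \o (fun w => (Z w ^+ 2)%R)]%E
     = ('N[P]_(2 + eta)%:E[EFin \o Z] `^ 2)%E.
    rewrite unlock -poweRrM invf_div; congr (_ `^ _)%E; last by rewrite mulrC.
    apply: eq_integral => w _ /=; congr EFin.
    rewrite ger0_norm ?sqr_ge0// -real_normK ?num_real//.
    rewrite -powR_mulrn// -powRrM; congr (_ `^ _); lra.
  (* [M] dominates a norm, hence is nonnegative, and [M ^+ 2] can be read as a real power. *)
  rewrite -powR_mulrn; last by rewrite -lee_fin (le_trans _ hZ) ?Lnorm_ge0.
  rewrite -poweR_EFin gt0_ler_poweR// in_itv/= leey ?Lnorm_ge0//.
  by rewrite (le_trans _ hZ) ?Lnorm_ge0.
- have -> : 'N[P]_((2 + eta) / eta)%:E[EFin \o \1_A]%E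
     = (P A `^ (eta / (2 + eta)))%E.
    rewrite unlock invf_div; congr (_ `^ _)%E.
    rewrite -[in RHS](setIT A) -integral_indic//.
    apply: eq_integral => w _ /=; congr EFin.
    rewrite indicE; case: (_ \in _); rewrite ?normr1 ?normr0 ?powR1 ?powR0//.
    by rewrite gt_eqF.
  rewrite -poweR_EFin gt0_ler_poweR ?in_itv/= ?leey ?lee_fin ?andbT//.
  by rewrite divr_ge0//; lra.
Qed.

End expectation_bounds.

(** * Moments of [f] along the two processes *)

(** By change of variables, the norm depends only on the law. This transfers the moment bound from
    [X] to [Y]. *)
Lemma Lnorm_eq_law d1 d2 (T : measurableType d1) (E : measurableType d2)
    (R : realType) (P : probability T R) (X Y : {RV P >-> E}) (f : E -> R)
    (p : R) :
  measurable_fun [set: E] f ->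
  (forall A, measurable A -> distribution P X A = distribution P Y A) ->
  'N[P]_p%:E[EFin \o (f \o X)]%E = 'N[P]_p%:E[EFin \o (f \o Y)]%E.
Proof.
move=> mf XY; rewrite unlock; congr (_ `^ _)%E.
pose g (e : E) : \bar R := (`|f e| `^ p)%:E.
have mg : measurable_fun [set: E] g.
  apply/measurable_EFinP; apply: (measurableT_comp (measurable_powR p)).
  exact: measurableT_comp.
have g0 e : (0 <= g e)%E by rewrite lee_fin powR_ge0.
rewrite -[LHS](ge0_integral_distribution X mg g0).
rewrite -[RHS](ge0_integral_distribution Y mg g0).
by apply: eq_measure_integral => A mA _; exact: XY.
Qed.

Lemma Lnorm_le_moment d (T : measurableType d) (R : realType)
    (P : probability T R) (Z : T -> R) (p D : R) :
  0 < p -> ('E_P[fun w => (`|Z w| `^ p)%R] <= D%:E)%E ->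
  ('N[P]_p%:E[EFin \o Z] <= (D `^ p^-1)%:E)%E.
Proof.
move=> p0; rewrite !unlock => ZD.
have Z0 : (0 <= \int[P]_w (`|Z w| `^ p)%:E)%E.
  by apply: integral_ge0 => w _; rewrite lee_fin powR_ge0.
rewrite -poweR_EFin gt0_ler_poweR ?in_itv/= ?leey ?andbT ?invr_ge0 ?(ltW p0)//.
exact: le_trans ZD.
Qed.

(** * Pathwise bound on the bias correction, and the geometric rate *)

(** The indicators absorb the random range of summation, so that each summand can be estimated
    separately at a fixed [l]; the minimum is bounded by its second argument. *)
Lemma bias_correction_le (R : realType) (T E : Type) (f : E -> R)
    (X Y : nat -> T -> E) (k N m : nat) (w : T) :
  (0 < N)%N -> m = (N + k - 1)%N ->
  exists n, `|bias_correction f X Y k m w| <=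
    \sum_(l < n) (l - k)%:R / N%:R
      * `|(f (X l w) - f (Y l.-1 w))
          * \1_[set v | (l%:R%:E < meeting_time R X Y v)%E] w|.
Proof.
move=> N0 ->; exists (Num.truncn (fine (meeting_time R X Y w))).
rewrite /bias_correction.
have -> : (N + k - 1)%:R - k%:R + 1 = N%:R :> R.
  by rewrite natrB ?natrD ?addn_gt0 ?N0//; ring.
set n := Num.truncn _.
rewrite -(big_mkord xpredT (fun l => (l - k)%:R / N%:R
  * `|(f (X l w) - f (Y l.-1 w))
      * \1_[set v | (l%:R%:E < meeting_time R X Y v)%E] w|)).
have [nk|kn] := leqP n k.+1.
  by rewrite [X in `|X|]big_geq// normr0 sumr_ge0// => l _; rewrite mulr_ge0 ?divr_ge0.
rewrite [leRHS](big_cat_nat _ (n := k.+1))//=; last exact: ltnW.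
apply: le_trans (_ : \sum_(k.+1 <= l < n) (l - k)%:R / N%:R
  * `|(f (X l w) - f (Y l.-1 w))
      * \1_[set v | (l%:R%:E < meeting_time R X Y v)%E] w| <= _); last first.
  by rewrite lerDr sumr_ge0// => l _; rewrite mulr_ge0 ?divr_ge0.
apply: le_trans (ler_norm_sum _ _ _) _.
rewrite big_nat_cond [leRHS]big_nat_cond.
apply: ler_sum => l /andP[/andP[kl ln] _].
(* An infinite meeting time gives [n = 0], which leaves no index [l]; a finite one exceeds every [l]
   below its integer part. *)
have -> : \1_[set v | (l%:R%:E < meeting_time R X Y v)%E] w = 1 :> R.
  rewrite indicE mem_set//=; move: ln; rewrite /n.
  case: (meeting_time R X Y w) => [t| |]/=; rewrite ?truncn0 ?ltry//.
  rewrite ltnNge truncn_le_nat -leNgt lte_fin; apply: lt_le_trans.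
  by rewrite ltr_nat.
have kl' : (k <= l)%N := ltnW kl.
rewrite mulr1 normrM ler_wpM2r// natrB//.
have a0 : 0 <= (l%:R - k%:R) / N%:R :> R by rewrite divr_ge0 ?subr_ge0 ?ler_nat.
by rewrite ger0_norm ?ge_min ?lexx ?orbT// le_min ler01.
Qed.

(** The Hoelder exponent [eta / (2 + eta)] is twice the exponent defining [delta_hat], so the tail
    bound becomes the square of a geometric term. *)
Lemma delta_hat_exprn_sqr (R : realType) (delta eta : R) (l : nat) :
  0 < delta -> 0 < eta ->
  (delta ^+ l) `^ (eta / (2 + eta)) = (delta_hat delta eta ^+ l) ^+ 2.
Proof.
move=> delta0 eta0; rewrite /delta_hat -(powR_mulrn l (ltW delta0)) -exprM.
rewrite -(powR_mulrn (l * 2) (powR_ge0 _ _)) -!powRrM natrM.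
have -> : eta / (2 + eta) = eta / (4 + 2 * eta) * 2.
  by field; apply/andP; split; lra.
by rewrite mulrCA.
Qed.

Lemma delta_hat_lt1 (R : realType) (delta eta : R) :
  0 < delta -> delta < 1 -> 0 < eta -> delta_hat delta eta < 1.
Proof.
move=> delta0 delta1 eta0; rewrite /delta_hat.
rewrite -[ltRHS](_ : 1 `^ (eta / (4 + 2 * eta)) = 1); last by rewrite powR1.
by rewrite gt0_ltr_powR ?nnegrE ?(ltW delta0)// divr_gt0//; lra.
Qed.

Theorem proposition2 (R : realType)
    (d : nat) (Omega : set (d.-tuple R))
    (x0 : d.-tuple R) (Omega_x0 : Omega x0)
    (pi : probability (borel_subspace Omega_x0) R)
    (f : borel_subspace Omega_x0 -> R)
    (f_meas : measurable_fun [set: borel_subspace Omega_x0] f)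
    (f_int : pi.-integrable [set: borel_subspace Omega_x0] (EFin \o f))
    (disp : measure_display) (T : measurableType disp) (P : probability T R)
    (X Y : nat -> {RV P >-> borel_subspace Omega_x0})
    (same_law : forall (t : nat) (A : set (borel_subspace Omega_x0)),
      measurable A -> distribution P (X t) A = distribution P (Y t) A)
    (eta D : R)
    (f_cvg : 'E_P[f \o X t]%E @[t --> \oo] --> 'E_pi[f]%E)
    (eta_gt0 : 0 < eta)
    (f_moment : forall t : nat,
      ('E_P[fun w => (`|f (X t w)| `^ (2 + eta))%R] <= D%:E)%E)
    (C delta : R)
    (tau_meas : measurable_fun [set: T] (meeting_time R X Y))
    (delta_gt0 : 0 < delta) (delta_lt1 : delta < 1)
    (tau_tail : forall t : nat,
      (P [set w | t%:R%:E < meeting_time R X Y w] <= (C * delta ^+ t)%:E)%E)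
    (coalesced : {ae P, forall w, forall t : nat,
      (meeting_time R X Y w <= t%:R%:E)%E -> X t w = Y t.-1 w})
    (k N m : nat) (N_gt0 : (0 < N)%N) (m_def : m = (N + k - 1)%N) :
  ('E_P[fun w => (bias_correction f X Y k m w ^+ 2)%R]
    <= (C_delta C D delta eta
        * (delta_hat delta eta ^+ (2 * k) / N%:R ^+ 2))%:E)%E.

Proof.
have e2 : 0 < 2 + eta by lra.
have h0 : 0 < delta_hat delta eta by rewrite powR_gt0.
have hsq l := delta_hat_exprn_sqr l delta_gt0 eta_gt0.
have h1 := delta_hat_lt1 delta_gt0 delta_lt1 eta_gt0.
set h := delta_hat delta eta in h0 h1 hsq *.
have mtau l : measurable [set w | (l%:R%:E < meeting_time R X Y w)%E].
  by rewrite -[X in measurable X]setTI; exact: emeasurable_fun_o_infty.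
(* The tail bound at [t = 0] forces the sign of [C]. *)
have C0 : 0 <= C.
  by have := le_trans (measure_ge0 _ _) (tau_tail 0%N); rewrite lee_fin expr0 mulr1.
have N0 : 0 < N%:R :> R by rewrite ltr0n.
pose a := D `^ (2 + eta)^-1.
have normX t : ('N[P]_(2 + eta)%:E[EFin \o (f \o X t)] <= a%:E)%E.
  exact: Lnorm_le_moment (f_moment t).
have normY t : ('N[P]_(2 + eta)%:E[EFin \o (f \o Y t)] <= a%:E)%E.
  rewrite -(@Lnorm_eq_law _ _ _ _ _ _ (X t))//.
  exact: same_law.
pose Z l w := f (X l w) - f (Y l.-1 w).
have mfX t : measurable_fun [set: T] (f \o X t) by exact: measurableT_comp.
have mfY t : measurable_fun [set: T] (f \o Y t) by exact: measurableT_comp.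
have mZ l : measurable_fun [set: T] (Z l).
  exact: measurable_funB (mfX l) (mfY l.-1).
have normZ l : ('N[P]_(2 + eta)%:E[EFin \o Z l] <= (2 * a)%:E)%E.
  have mN : measurable_fun [set: T] (\- (f \o Y l.-1))%R by exact: measurable_funN.
  have p1 : 1 <= 2 + eta by lra.
  apply: le_trans (minkowski_EFin P (mfX l) mN p1) _.
  have -> : 'N[P]_(2 + eta)%:E[EFin \o (\- (f \o Y l.-1))%R]%E
      = 'N[P]_(2 + eta)%:E[EFin \o (f \o Y l.-1)]%E.
    rewrite -[RHS]oppe_Lnorm; exact: eq_Lnorm.
  by rewrite mulr_natl mulr2n (EFinD a) leeD.
(* [K * (h ^+ l) ^+ 2] will bound the second moment of the truncated [Z l], and [S] the sums of
   [(l - k)%:R / N%:R * h ^+ l]. *)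
pose K := (2 * a) ^+ 2 * C `^ (eta / (2 + eta)).
pose S := h ^+ k * (h / (1 - h) ^+ 2) / N%:R.
have S0 : 0 < S by rewrite !mulr_gt0 ?exprn_gt0 ?invr_gt0 ?exprn_gt0//; lra.
apply: (@le_trans _ _ (K * S ^+ 2)%:E).
  apply: (@expectation_sqr_sum_le _ _ _ _ (fun l => (l - k)%:R / N%:R)
    (fun l => h ^+ l)
    (fun l w => Z l w * \1_[set v | (l%:R%:E < meeting_time R X Y v)%E] w)) => //.
  - by move=> l; rewrite exprn_gt0.
  - move=> n; under eq_bigr do rewrite mulrAC.
    by rewrite -mulr_suml ler_pM2r ?invr_gt0// sum_natr_expr_le.
  - by move=> l; apply: measurable_funM => //; exact: measurable_indic.
  (* Hoelder's bound carries the factor [(C * delta ^+ l)] to the power [eta / (2 + eta)], in which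
     [hsq] replaces the power of [delta ^+ l] by [(h ^+ l) ^+ 2]. *)
  - move=> l.
    have := expectation_sqr_indic_le eta_gt0 _ (mZ l) (mtau l) (normZ l)
      (tau_tail l).
    rewrite powRM ?exprn_ge0 ?(ltW delta_gt0)// hsq mulrA; apply => //.
    by rewrite mulr_ge0 ?exprn_ge0 ?(ltW delta_gt0).
  - by move=> w; exact: bias_correction_le.
rewrite lee_fin /C_delta -/h.
set r := (- (h `^ (- 1 / ln h) / ln h)) * ((1 - h) / h).
have -> : K = 4 * D `^ (2 / (2 + eta)) * C `^ (eta / (2 + eta)).
  rewrite /K exprMn; congr (_ * _ * _); first by ring.
  by rewrite -powR_mulrn ?powR_ge0// -powRrM mulrC.
have -> : S ^+ 2 = ((1 - h) ^+ 2 / h) ^- 2 * (h ^+ (2 * k) / N%:R ^+ 2).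
  rewrite /S mulnC exprM; field.
  by rewrite !gt_eqF//; lra.
rewrite [leLHS]mulrA ler_wpM2r ?divr_ge0 ?exprn_ge0 ?(ltW h0)//.
rewrite ler_wpM2l ?mulr_ge0 ?powR_ge0//.
(* All other factors agree with those of [C_delta]; only the numerator 1 remains to be compared with
   [3 + 2 * r ^+ 2]. *)
have r1 : 1 <= 3 + 2 * r ^+ 2 by have := sqr_ge0 r; lra.
by rewrite ler_peMl// invr_ge0 exprn_ge0// divr_ge0 ?sqr_ge0// ltW.
Qed.
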